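(* Let $k>2$ be an integer and let $M$ be a (real analytic or formal) hypersurface in $\mathbb C^2$ through the origin given by $v=F(x,y,u)$ with $$F(x,y,u)=x^k+\sum_{j+l+km\ge k+1}A_{j,l,m}\,x^jy^lu^m .$$ Then there is a unique formal transformation of the form $z^*=z+f(z,w)$, $w^*=w+g(z,w)$, where $$f(z,w)=\sum_{j+km>1}f_{jm}z^jw^m,\qquad g(z,w)=\sum_{j+km>k}g_{jm}z^jw^m ,$$ which takes $M$ into t-normal form.
   Context: Coordinates in $\mathbb C^2$ are $(z,w)$ with $z=x+iy$, $w=u+iv$; starred coordinates are $z^*=x^*+iy^*$, $w^*=u^*+iv^*$. The variables $z,x,y$ have weight $1$ and $w,u$ have weight $k$. All power series (the real power series $F$ in $x,y,u$ with real coefficients and the complex power series $f,g$) are allowed to be formal; formulas are interpreted in the sense of formal power series. A formal transformation takes $v=F(x,y,u)$ to $v^*=F^*(x^*,y^*,u^* )$ if the latter equation holds identically as a formal power series identity in $(x,y,u)$ after substituting $z^*=z+f(z,w)$, $w^*=w+g(z,w)$ and restricting to $v=F(x,y,u)$. Write $F(x,y,u)=x^k+\sum_{j,l}X_{j,l}(u)\,x^jy^l$ with $X_{j,l}(u)=\sum_m A_{j,l,m}u^m$ (so the leading term $x^k$ is not included in $X_{k,0}$). The hypersurface is in t-normal form if $$X_{0,j}=X_{1,j}=X_{k-1,j}=X_{k,j}=0\quad\text{for all } j=0,1,2,\dots,\qquad X_{2k-1,0}=X_{2k-1,1}=0 .$$ *)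

(* Defs.v *)
From mathcomp Require Import all_boot all_order all_algebra.
From mathcomp Require Import complex reals.
Set Implicit Arguments.
Unset Strict Implicit.
Unset Printing Implicit Defensive.
Import GRing.Theory.
Local Open Scope ring_scope.

(* Formal power series are given by their coefficients: for S : fps3 K,
   S a b c is the coefficient of x^a y^b u^c (in this order of variables),
   and for f : fps2 K, f j m is the coefficient of z^j w^m. *)
Definition fps2 (K : Type) : Type := nat -> nat -> K.
Definition fps3 (K : Type) : Type := nat -> nat -> nat -> K.

Section Fps.
Variable K : pzRingType.
Implicit Types S T P : fps3 K.

Definition fps3_mono (j l m : nat) : fps3 K :=
  fun a b c => ((a == j) && (b == l) && (c == m))%:R.

Definition fps3_add S T : fps3 K := fun a b c => S a b c + T a b c.

Definition fps3_mul S T : fps3 K := fun a b c =>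
  \sum_(i < a.+1) \sum_(j < b.+1) \sum_(l < c.+1)
     S i j l * T (a - i)%N (b - j)%N (c - l)%N.

Definition fps3_exp S (n : nat) : fps3 K :=
  iter n (fps3_mul S) (fps3_mono 0 0 0).

(* Substitution. The next two definitions are meaningful only when the substituted series
   have zero constant term: a product of n of them then has order at least n,
   so that terms with an exponent larger than a + b + c do not contribute to
   the coefficient of x^a y^b u^c and truncating the sum is exact. *)
Definition fps2_subst (f : fps2 K) S T : fps3 K := fun a b c =>
  \sum_(j < (a + b + c).+1) \sum_(m < (a + b + c).+1)
     f j m * fps3_mul (fps3_exp S j) (fps3_exp T m) a b c.

Definition fps3_subst P S T U : fps3 K := fun a b c =>
  \sum_(j < (a + b + c).+1) \sum_(l < (a + b + c).+1)
    \sum_(m < (a + b + c).+1)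
     P j l m *
     fps3_mul (fps3_mul (fps3_exp S j) (fps3_exp T l)) (fps3_exp U m) a b c.

End Fps.

Section Hypersurface.
Variable R : realType.
Implicit Types F : fps3 R.

Definition fps3_complex (S T : fps3 R) : fps3 R[i] :=
  fun a b c => (S a b c +i* T a b c)%C.
Definition fps3_Re (S : fps3 R[i]) : fps3 R := fun a b c => complex.Re (S a b c).
Definition fps3_Im (S : fps3 R[i]) : fps3 R := fun a b c => complex.Im (S a b c).

(* The coordinate functions z = x + iy and w = u + iv restricted to
   v = F(x,y,u). *)
Definition zM : fps3 R[i] :=
  fps3_complex (fps3_mono R 1 0 0) (fps3_mono R 0 1 0).
Definition wM F : fps3 R[i] := fps3_complex (fps3_mono R 0 0 1) F.

(* z^* = z + f(z,w) and w^* = w + g(z,w) restricted to v = F(x,y,u). *)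
Definition zstar (f : fps2 R[i]) F : fps3 R[i] :=
  fps3_add zM (fps2_subst f zM (wM F)).
Definition wstar (g : fps2 R[i]) F : fps3 R[i] :=
  fps3_add (wM F) (fps2_subst g zM (wM F)).

Definition takes (f g : fps2 R[i]) F Fstar : Prop :=
  forall a b c : nat,
    fps3_Im (wstar g F) a b c =
    fps3_subst Fstar (fps3_Re (zstar f F)) (fps3_Im (zstar f F))
      (fps3_Re (wstar g F)) a b c.

(* A k F j l m is the coefficient A_{j,l,m} in
   F = x^k + sum A_{j,l,m} x^j y^l u^m. *)
Definition A (k : nat) F (j l m : nat) : R := F j l m - fps3_mono R k 0 0 j l m.

(* X k F j l is the power series X_{j,l}(u), with m-th coefficient A_{j,l,m}. *)
Definition X (k : nat) F (j l : nat) : nat -> R := fun m => A k F j l m.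

Definition t_normal (k : nat) F : Prop :=
  (forall j m : nat, [/\ X k F 0 j m = 0, X k F 1 j m = 0,
                         X k F k.-1 j m = 0 & X k F k j m = 0]) /\
  (forall m : nat, X k F (2 * k).-1 0 m = 0 /\ X k F (2 * k).-1 1 m = 0).

End Hypersurface.

(* Main.v *)
Require Import Defs.
From mathcomp Require Import all_boot all_order all_algebra.
From mathcomp Require Import complex reals.
From mathcomp Require Import boolp zify ring.
Set Implicit Arguments.
Unset Strict Implicit.
Unset Printing Implicit Defensive.
Import GRing.Theory Num.Theory.
Local Open Scope ring_scope.

(** Give x, y, z weight 1 and u, w weight k.  Split the equation

      Im w* = F*(Re z*, Im z*, Re w* )

    restricted to v = F(x,y,u) into weighted homogeneous parts.  Because F and
    F* both start with x^k, the unknowns of highest weight enter the part of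
    weight k + n linearly, through

      Im g(z, u + i x^k) - k x^(k-1) Re f(z, u + i x^k) - F*(x,y,u)

    with f of weight n + 1 and g, F* of weight k + n; everything else depends
    only on unknowns of lower weight.  This is [defect_sub], in the form of a
    difference between two triples (f, g, F* ) that agree in lower weights.

    The theorem thus reduces to the linear problem for the operator
    [model_op], the first two terms above: the coefficients of
    x^0, x^1, x^(k-1), x^k and of x^(2k-1), x^(2k-1) y may be prescribed
    arbitrarily ([model_op_surj]), and in each weight they determine f and g
    ([model_op_inj]).  Write g_j(w) and f_j(w) for the coefficients of z^j.
    Putting w = u + i x^k and expanding z^j = (x + i y)^j, one reads off
      - Im(i^j g_j) from x^0 y^j, and Re(i^j g_j) for j >= 1 from x^1 y^(j-1);
      - Re(i^j f_j) from x^(k-1) y^j, and Im(i^j f_j) for j >= 2 from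
        x^k y^(j-1);
      - the derivatives of Im f_0 and Re f_1 from x^(2k-1) and x^(2k-1) y;
      - the derivative of Re g_0 from x^k.
    The system is triangular in this order.  The three derivatives leave three
    real constants Im f_0(0), Re f_1(0), Re g_0(0), and these vanish by the
    weight conditions on f and g.

    Uniqueness follows by induction on the weight.  For existence, solving the
    linear problem with the nonlinear remainder as right-hand side is a map on
    triples which gains one unit of agreement in weight; its iterates converge
    coefficientwise to a fixed point, and a fixed point is a solution.  That F*
    starts with x^k is itself a consequence of the transformation equation
    ([target_leading]), so uniqueness does not presuppose it. *)

(** * The weight filtration on power series in x, y, u *)

Section WeightFiltration.
Variables (K : pzRingType) (k : nat).
Implicit Types (S T D : fps3 K) (n p q e : nat).

Definition order_ge n S := forall a b c, (a + b + k * c < n)%N -> S a b c = 0.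
Definition agree n S T :=
  forall a b c, (a + b + k * c < n)%N -> S a b c = T a b c.

Definition fps3_sub S T : fps3 K := fun a b c => S a b c - T a b c.

Lemma agree_refl n S : agree n S S. Proof. by []. Qed.

Lemma agree_sym n S T : agree n S T -> agree n T S.
Proof. by move=> h a b c w; rewrite h. Qed.

Lemma agree_trans n S T D : agree n S T -> agree n T D -> agree n S D.
Proof. by move=> h h' a b c w; rewrite h // h'. Qed.

Lemma agree_le n n' S T : (n' <= n)%N -> agree n S T -> agree n' S T.
Proof. by move=> le h a b c w; apply: h; lia. Qed.

Lemma order_ge_sub n S T : agree n S T -> order_ge n (fps3_sub S T).
Proof. by move=> h a b c w; rewrite /fps3_sub h // subrr. Qed.

Lemma order_ge_agree n S T : agree n S T -> order_ge n T -> order_ge n S.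
Proof. by move=> h o a b c w; rewrite h // o. Qed.

Lemma order_ge_mono j l m n : (n <= j + l + k * m)%N ->
  order_ge n (fps3_mono K j l m).
Proof.
move=> le a b c w; rewrite /fps3_mono.
case: eqP => [ea|//]; case: eqP => [eb|//]; case: eqP => [ec|//].
by move: w; rewrite ea eb ec; lia.
Qed.

(** With e = 1 this compares leading parts; with larger e it says that
    multiplying by a series of order q shifts agreement by q. *)
Lemma agree_mul p q e S S' T T' :
  order_ge p S -> order_ge p S' -> order_ge q T -> order_ge q T' ->
  agree (p + e) S S' -> agree (q + e) T T' ->
  agree (p + q + e) (fps3_mul S T) (fps3_mul S' T').
Proof.
move=> oS oS' oT oT' aS aT a b c w.
apply: eq_bigr => i _; apply: eq_bigr => j _; apply: eq_bigr => l _.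
have hi := ltn_ord i; have hj := ltn_ord j; have hl := ltn_ord l.
have w2 : (k * c = k * l + k * (c - l))%N by rewrite -mulnDr; congr muln; lia.
have [w1|w1] := ltnP (i + j + k * l) p; first by rewrite oS // oS' // !mul0r.
have [w3|w3] := ltnP (a - i + (b - j) + k * (c - l)) q.
  by rewrite oT // oT' // !mulr0.
by rewrite aS ?aT //; lia.
Qed.

Lemma order_ge_mul p q S T :
  order_ge p S -> order_ge q T -> order_ge (p + q) (fps3_mul S T).
Proof.
move=> oS oT a b c w.
rewrite /fps3_mul big1 // => i _; rewrite big1 // => j _.
rewrite big1 // => l _.
have hi := ltn_ord i; have hj := ltn_ord j; have hl := ltn_ord l.
have w2 : (k * c = k * l + k * (c - l))%N by rewrite -mulnDr; congr muln; lia.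
have [w1|w1] := ltnP (i + j + k * l) p; first by rewrite oS // mul0r.
by rewrite oT ?mulr0 //; lia.
Qed.

Lemma fps3_expS S j : fps3_exp S j.+1 = fps3_mul S (fps3_exp S j).
Proof. by []. Qed.

Lemma order_ge_exp p S j : order_ge p S -> order_ge (j * p) (fps3_exp S j).
Proof.
move=> oS; elim: j => [|j IH]; first by move=> a b c; rewrite mul0n ltn0.
by rewrite mulSn; apply: order_ge_mul.
Qed.

Lemma agree_exp p e S S' j : order_ge p S -> order_ge p S' ->
  agree (p + e) S S' -> agree (j * p + e) (fps3_exp S j) (fps3_exp S' j).
Proof.
move=> oS oS' aS; elim: j => [//|j IH].
rewrite mulSn; apply: agree_mul => //; exact: order_ge_exp.
Qed.

Lemma fps3_mulBl S S' T a b c :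
  fps3_mul (fps3_sub S S') T a b c = fps3_mul S T a b c - fps3_mul S' T a b c.
Proof.
rewrite /fps3_mul -sumrB; apply: eq_bigr => i _.
rewrite -sumrB; apply: eq_bigr => j _; rewrite -sumrB.
by apply: eq_bigr => l _; rewrite mulrBl.
Qed.

Lemma fps3_mulBr S T T' a b c :
  fps3_mul S (fps3_sub T T') a b c = fps3_mul S T a b c - fps3_mul S T' a b c.
Proof.
rewrite /fps3_mul -sumrB; apply: eq_bigr => i _.
rewrite -sumrB; apply: eq_bigr => j _; rewrite -sumrB.
by apply: eq_bigr => l _; rewrite mulrBr.
Qed.

Lemma sum_ord_delta (n p : nat) (G : nat -> K) :
  \sum_(i < n) (nat_of_ord i == p)%:R * G i = if (p < n)%N then G p else 0.
Proof.
case: ltnP => h.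
  rewrite (bigD1 (Ordinal h)) //= eqxx mul1r big1 ?addr0 // => i ne.
  suff -> : (nat_of_ord i == p) = false by rewrite mul0r.
  by apply: contra_neqF ne => /eqP e; apply: val_inj.
by rewrite big1 // => i _; rewrite ltn_eqF ?mul0r // (leq_trans (ltn_ord i)).
Qed.

Lemma mul_mono_l p q e T a b c : fps3_mul (fps3_mono K p q e) T a b c =
  if [&& p <= a, q <= b & e <= c]%N then T (a - p)%N (b - q)%N (c - e)%N else 0.
Proof.
rewrite /fps3_mul /fps3_mono.
transitivity (\sum_(i < a.+1) (nat_of_ord i == p)%:R *
  \sum_(j < b.+1) (nat_of_ord j == q)%:R *
  \sum_(l < c.+1) (nat_of_ord l == e)%:R * T (a - i)%N (b - j)%N (c - l)%N).
  apply: eq_bigr => i _; rewrite mulr_sumr; apply: eq_bigr => j _.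
  rewrite !mulr_sumr; apply: eq_bigr => l _; rewrite !mulrA; congr (_ * _).
  by do 3!case: eqP => _ /=; rewrite ?mulr0 ?mul0r ?mulr1.
rewrite (sum_ord_delta _ _ (fun i => \sum_(j < b.+1) (nat_of_ord j == q)%:R *
  \sum_(l < c.+1) (nat_of_ord l == e)%:R * T (a - i)%N (b - j)%N (c - l)%N)).
rewrite ltnS; case: leqP => //= _.
rewrite (sum_ord_delta _ _ (fun j =>
  \sum_(l < c.+1) (nat_of_ord l == e)%:R * T (a - p)%N (b - j)%N (c - l)%N)).
rewrite ltnS; case: leqP => //= _.
rewrite (sum_ord_delta _ _ (fun l => T (a - p)%N (b - q)%N (c - l)%N)).
by rewrite ltnS; case: leqP.
Qed.

Lemma mul_mono_r p q e T a b c : fps3_mul T (fps3_mono K p q e) a b c =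
  if [&& p <= a, q <= b & e <= c]%N then T (a - p)%N (b - q)%N (c - e)%N else 0.
Proof.
rewrite -mul_mono_l /fps3_mul.
rewrite (reindex_inj rev_ord_inj); apply: eq_bigr => i _ /=.
rewrite (reindex_inj rev_ord_inj); apply: eq_bigr => j _ /=.
rewrite (reindex_inj rev_ord_inj); apply: eq_bigr => l _ /=.
have hi := ltn_ord i; have hj := ltn_ord j; have hl := ltn_ord l.
rewrite !subSS !subKn //= /fps3_mono.
by case: andP => _; rewrite /= ?mulr1n ?mulr0n ?mulr1 ?mul1r ?mulr0 ?mul0r.
Qed.

Lemma mul_mono p q e p' q' e' :
  fps3_mul (fps3_mono K p q e) (fps3_mono K p' q' e') =
  fps3_mono K (p + p') (q + q') (e + e').
Proof.
apply/funext => a; apply/funext => b; apply/funext => c.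
rewrite mul_mono_l /fps3_mono; case: ifP => h.
  by congr (nat_of_bool _)%:R; lia.
by rewrite (_ : _ && _ = false) //; lia.
Qed.

Lemma exp_mono p q e j :
  fps3_exp (fps3_mono K p q e) j = fps3_mono K (j * p) (j * q) (j * e).
Proof.
by elim: j => [//|j IH]; rewrite fps3_expS IH mul_mono !mulSn.
Qed.

Definition xshift j D : fps3 K :=
  fun a b c => if (j <= a)%N then D (a - j)%N b c else 0.

Lemma mul_xpow_l j D : fps3_mul (fps3_mono K j 0 0) D = xshift j D.
Proof.
apply/funext => a; apply/funext => b; apply/funext => c.
by rewrite mul_mono_l /xshift !leq0n !andbT !subn0.
Qed.

Lemma mul_xpow_r j D : fps3_mul D (fps3_mono K j 0 0) = xshift j D.
Proof.
apply/funext => a; apply/funext => b; apply/funext => c.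
by rewrite mul_mono_r /xshift !leq0n !andbT !subn0.
Qed.

Lemma order_ge_xshift j n D : order_ge n D -> order_ge (j + n) (xshift j D).
Proof.
by move=> o a b c w; rewrite /xshift; case: leqP => // h; apply: o; lia.
Qed.

Lemma exp_xpow j : fps3_exp (fps3_mono K 1 0 0) j = fps3_mono K j 0 0.
Proof. by rewrite exp_mono muln1 !muln0. Qed.

(** The derivative of the j+1-st power at x: if S and S' start with x, then
    the leading part of S^(j+1) - S'^(j+1) is (j+1) x^j (S - S'), by
    induction from S^(j+1) - S'^(j+1) = S (S^j - S'^j) + (S - S') S'^j. *)
Lemma sub_exp e S S' j : (0 < e)%N ->
  agree 2 S (fps3_mono K 1 0 0) -> agree 2 S' (fps3_mono K 1 0 0) ->
  agree e.+1 S S' ->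
  agree (j + e).+2 (fps3_sub (fps3_exp S j.+1) (fps3_exp S' j.+1))
    (fun a b c => xshift j (fps3_sub S S') a b c *+ j.+1).
Proof.
move=> e_gt0 aS aS' aSS'.
have ox : order_ge 1 (fps3_mono K 1 0 0) by exact: order_ge_mono.
have oS : order_ge 1 S by apply: order_ge_agree ox; apply: agree_le aS.
have oS' : order_ge 1 S' by apply: order_ge_agree ox; apply: agree_le aS'.
elim: j => [|j IH] a b c w.
  rewrite /fps3_sub /xshift subn0 mulr1n /fps3_exp /=.
  by rewrite !mul_mono_r !leq0n !subn0.
have -> : fps3_sub (fps3_exp S j.+2) (fps3_exp S' j.+2) a b c =
    fps3_mul S (fps3_sub (fps3_exp S j.+1) (fps3_exp S' j.+1)) a b c +
    fps3_mul (fps3_sub S S') (fps3_exp S' j.+1) a b c.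
  rewrite fps3_mulBr fps3_mulBl /fps3_sub.
  by rewrite [fps3_exp S j.+2]fps3_expS [fps3_exp S' j.+2]fps3_expS addrA subrK.
rewrite mulrSr; congr (_ + _); last first.
  rewrite -mul_xpow_r -exp_xpow.
  apply: (@agree_mul e.+1 (j.+1 * 1) 1) => //; last by lia.
  - exact: order_ge_sub.
  - exact: order_ge_sub.
  - exact: order_ge_exp.
  - exact: order_ge_exp.
  - by apply: agree_exp.
rewrite (@agree_mul 1 (j + e).+1 1 _ (fps3_mono K 1 0 0) _ 
   (fun a b c => xshift j (fps3_sub S S') a b c *+ j.+1)) //; last by lia.
- rewrite mul_xpow_l /xshift.
  by case: (a) => [|a']; rewrite ?mul0rn // subSS subn0.
- apply: order_ge_sub; apply: (@agree_le (j.+1 * 1 + e)); first by lia.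
  exact: agree_exp.
- move=> a' b' c' w'; rewrite (@order_ge_xshift j e.+1) ?mul0rn //; last by lia.
  exact: order_ge_sub.
- by rewrite addn1.
Qed.

End WeightFiltration.

(** * Substitution into a real series *)

Section Substitution.
Variables (K : comPzRingType) (k : nat).
Implicit Types (S T U P : fps3 K).

Definition subst_mono S T U (j l m : nat) : fps3 K :=
  fps3_mul (fps3_mul (fps3_exp S j) (fps3_exp T l)) (fps3_exp U m).

Lemma agree_subst_mono e S S' T T' U U' j l m :
  order_ge k 1 S -> order_ge k 1 S' -> order_ge k 1 T -> order_ge k 1 T' ->
  order_ge k k U -> order_ge k k U' ->
  agree k (1 + e) S S' -> agree k (1 + e) T T' -> agree k (k + e) U U' ->
  agree k (j + l + k * m + e) (subst_mono S T U j l m)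
    (subst_mono S' T' U' j l m).
Proof.
move=> oS oS' oT oT' oU oU' aS aT aU.
rewrite -{1}[j]muln1 -{1}[l]muln1 [(k * m)%N]mulnC.
apply: agree_mul; do 2?apply: order_ge_mul; try exact: order_ge_exp;
  try exact: agree_exp.
by apply: agree_mul; try exact: order_ge_exp; exact: agree_exp.
Qed.

Lemma subst_mono_coordinates j l m :
  subst_mono (fps3_mono K 1 0 0) (fps3_mono K 0 1 0) (fps3_mono K 0 0 1) j l m =
  fps3_mono K j l m.
Proof.
by rewrite /subst_mono !exp_mono !mul_mono !muln1 !muln0 !addn0 !add0n.
Qed.

Lemma sum3_delta n p q r (G : nat -> nat -> nat -> K) :
  \sum_(j < n) \sum_(l < n) \sum_(m < n) fps3_mono K p q r j l m * G j l m =
  if [&& p < n, q < n & r < n]%N then G p q r else 0.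
Proof.
transitivity (\sum_(j < n) (nat_of_ord j == p)%:R *
  \sum_(l < n) (nat_of_ord l == q)%:R *
  \sum_(m < n) (nat_of_ord m == r)%:R * G j l m).
  apply: eq_bigr => j _; rewrite mulr_sumr; apply: eq_bigr => l _.
  rewrite !mulr_sumr; apply: eq_bigr => m _; rewrite !mulrA; congr (_ * _).
  by rewrite /fps3_mono; do 3!case: eqP => _ /=; rewrite ?mulr0 ?mul0r ?mulr1.
rewrite (sum_ord_delta _ _ (fun j => \sum_(l < n) (nat_of_ord l == q)%:R *
  \sum_(m < n) (nat_of_ord m == r)%:R * G j l m)).
case: ltnP => //= _.
rewrite (sum_ord_delta _ _ (fun l =>
  \sum_(m < n) (nat_of_ord m == r)%:R * G p l m)).
case: ltnP => //= _.
by rewrite (sum_ord_delta _ _ (G p q)).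
Qed.

Section Difference.
Variables (S S' T T' U U' P P' : fps3 K) (e : nat).
Hypotheses (k_gt0 : (0 < k)%N).
Hypotheses (aS : agree k 2 S (fps3_mono K 1 0 0)).
Hypotheses (aT : agree k 2 T (fps3_mono K 0 1 0)).
Hypotheses (aU : agree k k.+1 U (fps3_mono K 0 0 1)).

Let oS : order_ge k 1 S.
Proof. apply: order_ge_agree (agree_le _ aS) _ => //; exact: order_ge_mono. Qed.
Let oT : order_ge k 1 T.
Proof. apply: order_ge_agree (agree_le _ aT) _ => //; exact: order_ge_mono. Qed.
Let oU : order_ge k k U.
Proof.
apply: order_ge_agree (agree_le _ aU) _ => //; apply: order_ge_mono.
by rewrite muln1.
Qed.

(** The substituted series start with x, y, u, so a monomial of P - P' of
    lowest weight reproduces itself up to terms of higher weight. *)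
Lemma subst_sub_outer n : agree k n P P' ->
  agree k n.+1 (fps3_sub (fps3_subst P S T U) (fps3_subst P' S T U))
    (fps3_sub P P').
Proof.
move=> aP a b c w; rewrite /fps3_sub /fps3_subst -sumrB.
rewrite -[RHS](_ : (if [&& a < (a + b + c).+1, b < (a + b + c).+1
    & c < (a + b + c).+1]%N then P a b c - P' a b c else 0) = _); last first.
  by rewrite ifT //; lia.
rewrite -(@sum3_delta _ a b c (fun j l m => P j l m - P' j l m)).
apply: eq_bigr => j _; rewrite -sumrB.
apply: eq_bigr => l _; rewrite -sumrB; apply: eq_bigr => m _.
rewrite -mulrBl -/(subst_mono S T U j l m).
have [lt|ge] := ltnP (j + l + k * m) n.
  by rewrite aP // subrr mul0r mulr0.
rewrite (@agree_subst_mono 1 S (fps3_mono K 1 0 0) T (fps3_mono K 0 1 0)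
           U (fps3_mono K 0 0 1)) //.
- rewrite subst_mono_coordinates mulrC /fps3_mono.
  by rewrite (eq_sym a) (eq_sym b) (eq_sym c).
- exact: order_ge_mono.
- exact: order_ge_mono.
- by apply: order_ge_mono; rewrite muln1.
- by rewrite addn1.
- by move: w; lia.
Qed.

Hypotheses (e_gt0 : (0 < e)%N).
Hypotheses (aS' : agree k 2 S' (fps3_mono K 1 0 0)).
Hypotheses (aT' : agree k 2 T' (fps3_mono K 0 1 0)).
Hypotheses (aU' : agree k k.+1 U' (fps3_mono K 0 0 1)).
Hypotheses (aP' : agree k k.+1 P' (fps3_mono K k 0 0)).
Hypotheses (aSS' : agree k (1 + e) S S').
Hypotheses (aTT' : agree k (1 + e) T T').
Hypotheses (aUU' : agree k (k + e) U U').

Let oS' : order_ge k 1 S'.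
Proof.
apply: order_ge_agree (agree_le _ aS') _ => //; exact: order_ge_mono.
Qed.
Let oT' : order_ge k 1 T'.
Proof.
apply: order_ge_agree (agree_le _ aT') _ => //; exact: order_ge_mono.
Qed.
Let oU' : order_ge k k U'.
Proof.
apply: order_ge_agree (agree_le _ aU') _ => //; apply: order_ge_mono.
by rewrite muln1.
Qed.

(** Changing the substituted series at relative weight e changes a monomial
    of P' of weight d first at weight d + e; hence only x^k, the part of P' of
    lowest weight, is felt at weight k + e, and there by its derivative. *)
Lemma subst_sub_inner :
  agree k (k + e).+1 (fps3_sub (fps3_subst P' S T U) (fps3_subst P' S' T' U'))
    (fun a b c => xshift k.-1 (fps3_sub S S') a b c *+ k).
Proof.
move=> a b c w; rewrite /fps3_sub /fps3_subst -sumrB.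
transitivity (\sum_(j < (a + b + c).+1) \sum_(l < (a + b + c).+1)
  \sum_(m < (a + b + c).+1) fps3_mono K k 0 0 j l m *
   (subst_mono S T U j l m a b c - subst_mono S' T' U' j l m a b c)).
  apply: eq_bigr => j _; rewrite -sumrB.
  apply: eq_bigr => l _; rewrite -sumrB; apply: eq_bigr => m _.
  rewrite -mulrBr -/(subst_mono S T U j l m) -/(subst_mono S' T' U' j l m).
  have [lt|ge] := ltnP (j + l + k * m) k.+1; first by rewrite aP'.
  by rewrite (@agree_subst_mono e S S' T T' U U') ?subrr ?mulr0 //; lia.
rewrite (sum3_delta _ _ _ _ (fun j l m =>
  subst_mono S T U j l m a b c - subst_mono S' T' U' j l m a b c)).
rewrite ltnS ltn0Sn /= andbT.
have -> : subst_mono S T U k 0 0 a b c - subst_mono S' T' U' k 0 0 a b c =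
    xshift k.-1 (fps3_sub S S') a b c *+ k.
  rewrite /subst_mono !mul_mono_r !leq0n !subn0 /=.
  move: k_gt0 aS aS' aSS' w; case: (k) => // k' _ aS1 aS1' aSS1 w.
  exact: (sub_exp e_gt0 aS1 aS1' aSS1).
(* If a + b + c < k, the exponent k lies beyond the truncation of the sum
   that defines substitution; then k - 1 <= a forces (a,b,c) = (k-1,0,0). *)
case: leqP => // h; rewrite /xshift; case: leqP => h'; last by rewrite mul0rn.
have -> : (a - k.-1 = 0)%N by lia.
have -> : b = 0%N by lia.
have -> : c = 0%N by lia.
by rewrite /fps3_sub aSS' ?subrr ?mul0rn // muln0.
Qed.

Lemma subst_sub : agree k (k + e) P P' ->
  agree k (k + e).+1 (fps3_sub (fps3_subst P S T U) (fps3_subst P' S' T' U'))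
    (fun a b c => P a b c - P' a b c + xshift k.-1 (fps3_sub S S') a b c *+ k).
Proof.
move=> aP a b c w; rewrite -(subst_sub_inner w).
rewrite -[P a b c - _]/(fps3_sub P P' a b c) -(subst_sub_outer aP w).
by rewrite /fps3_sub addrA subrK.
Qed.

End Difference.
End Substitution.

(** * Restriction of holomorphic series to the hypersurface *)

Section HolomorphicRestriction.
Variables (K : comPzRingType) (k : nat).
Implicit Types (h : fps2 K) (S T W : fps3 K).

Definition fps2_sub h h' : fps2 K := fun j m => h j m - h' j m.

Lemma fps2_subst_sub h h' S W :
  fps2_subst (fps2_sub h h') S W =
  fps3_sub (fps2_subst h S W) (fps2_subst h' S W).
Proof.
apply/funext => a; apply/funext => b; apply/funext => c.
rewrite /fps3_sub /fps2_subst -sumrB; apply: eq_bigr => j _.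
by rewrite -sumrB; apply: eq_bigr => m _; rewrite mulrBl.
Qed.

Lemma order_ge_fps2_subst h n S W : order_ge k 1 S -> order_ge k k W ->
  (forall j m, (j + k * m < n)%N -> h j m = 0) ->
  order_ge k n (fps2_subst h S W).
Proof.
move=> oS oW h0 a b c w.
rewrite /fps2_subst big1 // => j _; rewrite big1 // => m _.
have [lt|ge] := ltnP (j + k * m) n; first by rewrite h0 // mul0r.
rewrite (@order_ge_mul _ k (j * 1) (m * k)) ?mulr0 //; last by lia.
- exact: order_ge_exp.
- exact: order_ge_exp.
Qed.

(** The part of lowest weight of h(z,w) only sees the leading parts of z and w.
    It is used to replace w = u + i F by u + i x^k. *)
Lemma agree_fps2_subst h n S S' W W' : order_ge k 1 S -> order_ge k 1 S' ->
  order_ge k k W -> order_ge k k W' -> agree k 2 S S' -> agree k k.+1 W W' ->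
  (forall j m, (j + k * m < n)%N -> h j m = 0) ->
  agree k n.+1 (fps2_subst h S W) (fps2_subst h S' W').
Proof.
move=> oS oS' oW oW' aS aW h0 a b c w.
apply: eq_bigr => j _; apply: eq_bigr => m _.
have [lt|ge] := ltnP (j + k * m) n; first by rewrite h0 // !mul0r.
congr (_ * _).
apply: (@agree_mul _ k (j * 1) (m * k) 1); try exact: order_ge_exp; last by lia.
- exact: agree_exp.
- by apply: agree_exp => //; rewrite addn1.
Qed.

Lemma fps3_mulDl (t : K) S S' T a b c :
  fps3_mul (fun a b c => S a b c + t * S' a b c) T a b c =
  fps3_mul S T a b c + t * fps3_mul S' T a b c.
Proof.
rewrite /fps3_mul mulr_sumr -big_split; apply: eq_bigr => i _ /=.
rewrite mulr_sumr -big_split; apply: eq_bigr => j _ /=.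
rewrite mulr_sumr -big_split; apply: eq_bigr => l _ /=.
by rewrite mulrDl mulrA.
Qed.

End HolomorphicRestriction.

Section ModelRestriction.
Variables (R : realType) (k : nat).
Hypothesis k_gt0 : (0 < k)%N.
Implicit Types (h : fps2 R[i]).

(** The part of lowest weight of w = u + i F. *)
Definition wModel : fps3 R[i] := wM (fps3_mono R k 0 0).

Lemma zME : zM R =
  fun a b c => fps3_mono _ 1 0 0 a b c + 'i%C * fps3_mono _ 0 1 0 a b c.
Proof.
apply/funext => a; apply/funext => b; apply/funext => c.
rewrite /zM /fps3_complex /fps3_mono.
by do 2!case: andP => _; simpc.
Qed.

Lemma wModelE : wModel =
  fun a b c => fps3_mono _ 0 0 1 a b c + 'i%C * fps3_mono _ k 0 0 a b c.
Proof.
apply/funext => a; apply/funext => b; apply/funext => c.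
rewrite /wModel /wM /fps3_complex /fps3_mono.
by do 2!case: andP => _; simpc.
Qed.

Lemma exp_zM j a b c : fps3_exp (zM R) j a b c =
  ((c == 0) && (a + b == j)%N)%:R * ('C(j, b)%:R * 'i%C ^+ b).
Proof.
elim: j a b c => [|j IH] a b c.
  rewrite /fps3_exp /= /fps3_mono andbC addn_eq0.
  case: a => [|a]; case: b => [|b]; rewrite ?mul0r //= ?mul0r //.
  - by rewrite bin0 expr0 !mulr1.
  - by rewrite andbF mul0r.
  - by rewrite andbF mul0r.
  - by rewrite andbF mul0r.
rewrite fps3_expS zME fps3_mulDl -zME !mul_mono_l !IH.
case: a => [|a]; case: b => [|b] /=; rewrite ?subn0 ?subn1 /= ?leq0n.
- by rewrite andbF mul0r mulr0 addr0.
- rewrite !add0n eqSS add0r; case: (c == 0); last by rewrite !mul0r mulr0.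
  case: eqP => [->|_]; last by rewrite !mul0r mulr0.
  by rewrite !binn !mul1r exprS.
- by rewrite !addn0 eqSS mulr0 addr0 !bin0.
- have -> : (a.+1 + b == j)%N = (a + b.+1 == j)%N by lia.
  have -> : (a.+1 + b.+1 == j.+1)%N = (a + b.+1 == j)%N by lia.
  rewrite [X in _ + X = _]mulrCA -mulrDr; congr (_ * _).
  by rewrite binS natrD mulrDl exprS; ring.
Qed.

Lemma exp_wModel m a b c : fps3_exp wModel m a b c =
  ((b == 0) && (a + k * c == k * m)%N)%:R * ('C(m, c)%:R * 'i%C ^+ (m - c)).
Proof.
elim: m a b c => [|m IH] a b c.
  have -> : (a + k * c == k * 0)%N = (a == 0) && (c == 0) by nia.
  rewrite /fps3_exp /= /fps3_mono andbCA andbA.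
  case: (a == 0); case: (b == 0); rewrite /= ?mul0r //.
  by case: c => [|c]; rewrite ?mul0r // bin0 subn0 expr0 !mulr1.
rewrite fps3_expS wModelE fps3_mulDl -wModelE !mul_mono_l !IH.
rewrite /= !subn0 leq0n /= andbT.
case: (b == 0) => /=; last by rewrite !mul0r !if_same mulr0 addr0.
case: c => [|c].
  rewrite /= add0r !subn0 !bin0 !muln0 !addn0 mulnS exprS.
  case: leqP => h.
    have -> : (a - k == k * m)%N = (a == k + k * m)%N by lia.
    by ring.
  have -> : (a == k + k * m)%N = false by lia.
  by rewrite mulr0 mul0r.
rewrite /= subn1 /= !subSS !mulnS binS natrD.
have -> : (a + (k + k * c) == k + k * m)%N = (a + k * c == k * m)%N by lia.
case: leqP => h.
  have -> : (a - k + (k + k * c) == k * m)%N = (a + k * c == k * m)%N by lia.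
  case: eqP => [e|_]; last by rewrite !mul0r mulr0 addr0.
  have lt : (c < m)%N by rewrite -(ltn_pmul2l k_gt0); lia.
  have -> : (m - c = (m - c.+1).+1)%N by lia.
  by rewrite exprS; ring.
case: eqP => [e|_]; last by rewrite !mul0r mulr0 addr0.
have le : (m < c.+1)%N by rewrite -(ltn_pmul2l k_gt0) mulnS; lia.
by rewrite mulr0 addr0 (bin_small le) add0r.
Qed.

Lemma mul_exp_zM_wModel j m a b c :
  fps3_mul (fps3_exp (zM R) j) (fps3_exp wModel m) a b c =
  \sum_(i < a.+1) (j == i + b)%N%:R * ((a - i + k * c == k * m)%N%:R *
    ('C(j, b)%:R * 'C(m, c)%:R * 'i%C ^+ (b + (m - c)))).
Proof.
apply: eq_bigr => i _.
transitivity (\sum_(j' < b.+1) (nat_of_ord j' == b)%:R *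
  \sum_(l < c.+1) (nat_of_ord l == 0)%:R * ((j == i + b)%N%:R *
    ((a - i + k * c == k * m)%N%:R *
      ('C(j, b)%:R * 'C(m, c)%:R * 'i%C ^+ (b + (m - c)))) : R[i])).
  apply: eq_bigr => j' _; rewrite mulr_sumr; apply: eq_bigr => l _.
  rewrite exp_zM exp_wModel.
  have -> : (b - j' == 0)%N = (nat_of_ord j' == b).
    by have := ltn_ord j'; lia.
  have [->|_] := eqVneq (nat_of_ord j') b; last by rewrite /= !(mul0r, mulr0).
  have [->|_] := eqVneq (nat_of_ord l) 0%N; last by rewrite /= !(mul0r, mulr0).
  rewrite /= subn0 (eq_sym j).
  case: (_ == j); last by rewrite /= !(mul0r, mulr0).
  case: (_ == _); last by rewrite /= !(mul0r, mulr0).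
  by rewrite exprD; ring.
rewrite (sum_ord_delta _ _
  (fun _ => \sum_(l < c.+1) (nat_of_ord l == 0)%:R * _)).
rewrite ltnSn.
by rewrite (sum_ord_delta _ _ (fun _ => _)).
Qed.

(** Binomial expansion of h(x + i y, u + i x^k), where i is the exponent of x
    contributed by z^j, so that w^m contributes x^(a-i). *)
Lemma subst_zM_wModel h a b c :
  fps2_subst h (zM R) wModel a b c =
  \sum_(i < a.+1) \sum_(m < (a + b + c).+1) (a - i + k * c == k * m)%N%:R *
    (h (i + b)%N m *
      ('C(i + b, b)%:R * 'C(m, c)%:R * 'i%C ^+ (b + (m - c)))).
Proof.
rewrite /fps2_subst exchange_big /= [RHS]exchange_big /=; apply: eq_bigr => m _.
transitivity (\sum_(j < (a + b + c).+1) \sum_(i < a.+1)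
  (nat_of_ord j == i + b)%N%:R * ((a - i + k * c == k * m)%N%:R *
    (h j m * ('C(j, b)%:R * 'C(m, c)%:R * 'i%C ^+ (b + (m - c)))))).
  apply: eq_bigr => j _; rewrite mul_exp_zM_wModel mulr_sumr.
  by apply: eq_bigr => i _; ring.
rewrite exchange_big; apply: eq_bigr => i _ /=.
rewrite (sum_ord_delta _ _ (fun j => (a - i + k * c == k * m)%N%:R *
    (h j m * ('C(j, b)%:R * 'C(m, c)%:R * 'i%C ^+ (b + (m - c)))))).
by rewrite ifT //; have := ltn_ord i; lia.
Qed.

Lemma sum2_delta n n' p q (G : nat -> nat -> R[i]) : (p < n)%N -> (q < n')%N ->
  \sum_(i < n) \sum_(m < n')
    ((nat_of_ord i == p) && (nat_of_ord m == q))%:R * G i m = G p q.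
Proof.
move=> pn qn.
transitivity (\sum_(i < n) (nat_of_ord i == p)%:R *
    \sum_(m < n') (nat_of_ord m == q)%:R * G i m).
  apply: eq_bigr => i _; rewrite mulr_sumr; apply: eq_bigr => m _.
  by case: eqP => _; rewrite /= ?mul1r ?mul0r.
rewrite (sum_ord_delta _ _
  (fun i => \sum_(m < n') (nat_of_ord m == q)%:R * G i m)).
by rewrite pn (sum_ord_delta _ _ (G p)) qn.
Qed.

(** Below x^k only the terms u^m of the powers of w = u + i x^k contribute. *)
Lemma subst_model_lt h a b c : (a < k)%N ->
  fps2_subst h (zM R) wModel a b c =
  h (a + b)%N c * ('C(a + b, b)%:R * 'i%C ^+ b).
Proof.
move=> ak; rewrite subst_zM_wModel.
transitivity (\sum_(i < a.+1) \sum_(m < (a + b + c).+1)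
  ((nat_of_ord i == a) && (nat_of_ord m == c))%:R * (h (i + b)%N m *
      ('C(i + b, b)%:R * 'C(m, c)%:R * 'i%C ^+ (b + (m - c))))).
  apply: eq_bigr => i _; apply: eq_bigr => m _; congr (_ * _).
  congr (nat_of_bool _)%:R; have hi := ltn_ord i.
  apply/eqP/andP => [e|[/eqP -> /eqP ->]]; last by lia.
  have le : (c <= m)%N by rewrite -(leq_pmul2l k_gt0) -e; lia.
  have lt : (m < c.+1)%N by rewrite -(ltn_pmul2l k_gt0) -e mulnS; lia.
  have mE : m = c :> nat by lia.
  by move: e; rewrite mE eqxx => e; split=> //; apply/eqP; lia.
rewrite (@sum2_delta _ _ a c (fun i m => h (i + b)%N m *
      ('C(i + b, b)%:R * 'C(m, c)%:R * 'i%C ^+ (b + (m - c))))) //; last by lia.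
by rewrite binn subnn addn0 mulr1.
Qed.

(** From x^k up to x^(2k-1) there is one further contribution, from the term
    i m u^(m-1) x^k of w^m. *)
Lemma subst_model_ge h a b c : (k <= a < 2 * k)%N ->
  fps2_subst h (zM R) wModel a b c =
  h (a + b)%N c * ('C(a + b, b)%:R * 'i%C ^+ b)
  + h (a - k + b)%N c.+1 * ('C(a - k + b, b)%:R * c.+1%:R * 'i%C ^+ b.+1).
Proof.
move=> ak; rewrite subst_zM_wModel.
pose G i m := h (i + b)%N m *
      ('C(i + b, b)%:R * 'C(m, c)%:R * 'i%C ^+ (b + (m - c))).
transitivity (
  \sum_(i < a.+1) \sum_(m < (a + b + c).+1)
    ((nat_of_ord i == a) && (nat_of_ord m == c))%:R * G i m +
  \sum_(i < a.+1) \sum_(m < (a + b + c).+1)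
    ((nat_of_ord i == a - k)%N && (nat_of_ord m == c.+1))%:R * G i m).
  rewrite -big_split; apply: eq_bigr => i _ /=.
  rewrite -big_split; apply: eq_bigr => m _ /=.
  rewrite -mulrDl -natrD; congr (_%:R * _); have hi := ltn_ord i.
  have -> : (a - i + k * c == k * m)%N = 
     ((nat_of_ord i == a) && (nat_of_ord m == c)) ||
     ((nat_of_ord i == a - k)%N && (nat_of_ord m == c.+1)).
    apply/eqP/orP => [e|[]/andP[/eqP -> /eqP ->]]; [|by lia|].
      have [ia|ia] := eqVneq (i : nat) a.
        left; rewrite /= -(eqn_pmul2l k_gt0) -e; lia.
      right; have le : (c <= m)%N by rewrite -(leq_pmul2l k_gt0) -e; lia.
      have lt : (m < c.+2)%N by rewrite -(ltn_pmul2l k_gt0) -e !mulnS; lia.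
      have mE : m = c.+1 :> nat.
        have [mc|] := eqVneq (m : nat) c; last by lia.
        by move: e; rewrite mc; lia.
      by move: e; rewrite mE mulnS eqxx andbT => e; apply/eqP; lia.
    by rewrite mulnS; lia.
  by case: eqP => [->|_]; case: eqP => [->|_] //=; lia.
rewrite !sum2_delta /G; try lia.
by rewrite binn subnn addn0 mulr1 binSn subSnn addn1.
Qed.

End ModelRestriction.

(** * The linearized problem *)

Section LinearizedProblem.
Variables (R : realType) (k : nat).
Hypothesis k_gt2 : (2 < k)%N.
Implicit Types (f g : fps2 R[i]) (P : fps3 R) (z : R[i]).

Local Notation Re := (@complex.Re R).
Local Notation Im := (@complex.Im R).

Lemma Re_mul_nat z n : Re (z * n%:R) = Re z * n%:R.
Proof. by rewrite -(rmorph_nat (real_complex R)); case: z => x y; simpc. Qed.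
Lemma Im_mul_nat z n : Im (z * n%:R) = Im z * n%:R.
Proof. by rewrite -(rmorph_nat (real_complex R)); case: z => x y; simpc. Qed.
Lemma ReB z z' : Re (z - z') = Re z - Re z'.
Proof. by case: z z' => x y [x' y']. Qed.
Lemma ImB z z' : Im (z - z') = Im z - Im z'.
Proof. by case: z z' => x y [x' y']. Qed.
Lemma ReD z z' : Re (z + z') = Re z + Re z'.
Proof. by case: z z' => x y [x' y']. Qed.
Lemma ImD z z' : Im (z + z') = Im z + Im z'.
Proof. by case: z z' => x y [x' y']. Qed.
Lemma Re_mul_i z : Re (z * 'i%C) = - Im z. Proof. exact: ReiNIm. Qed.
Lemma Im_mul_i z : Im (z * 'i%C) = Re z. Proof. exact: ImiRe. Qed.

Lemma i_neq0 : 'i%C != 0 :> R[i].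
Proof. by rewrite eq_complex /= eqxx /= oner_eq0. Qed.

(** The linear equations determine the real and the imaginary part of
    i^j times the coefficient of z^j separately, by different equations. *)
Lemma eq0_rotated z j :
  Re (z * 'i%C ^+ j) = 0 -> Im (z * 'i%C ^+ j) = 0 -> z = 0.
Proof.
move=> re im; have : z * 'i%C ^+ j = 0.
  by case: (z * _) re im => x y; rewrite /= => -> ->.
by move/eqP; rewrite mulf_eq0 expf_eq0 (negPf i_neq0) andbF orbF => /eqP.
Qed.

(** The linear part of the transformation equation, as a function of the
    holomorphic unknowns. *)
Definition model_op f g : fps3 R := fun a b c =>
  Im (fps2_subst g (zM R) (wModel R k) a b c) -
  xshift k.-1 (fps3_Re (fps2_subst f (zM R) (wModel R k))) a b c *+ k.

Let k_gt0 : (0 < k)%N. Proof. by lia. Qed.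

(** The contribution of a term c z^j, with c the last argument, to the
    coefficient of x^(j-b) y^b.  It stands for the unknowns which earlier
    equations of the triangular system already determine. *)
Definition taylor_coef (j b : nat) z : R[i] := z * ('C(j, b)%:R * 'i%C ^+ b).

Lemma model_op_0 f g b c : model_op f g 0 b c = Im (g b c * 'i%C ^+ b).
Proof.
rewrite /model_op /xshift ifF ?mul0rn ?subr0; last by lia.
by rewrite subst_model_lt // add0n binn mul1r.
Qed.

Lemma model_op_1 f g b c :
  model_op f g 1 b c = - (Re (g b.+1 c * 'i%C ^+ b.+1) * b.+1%:R).
Proof.
rewrite /model_op /xshift ifF ?mul0rn ?subr0; last by lia.
rewrite subst_model_lt ?add1n ?binSn; [|by lia|by lia].
by rewrite -Re_mul_nat exprSr -[LHS]opprK -Re_mul_i; congr (- Re _); ring.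
Qed.

Lemma model_op_k1 f g b c :
  model_op f g k.-1 b c =
  Im (taylor_coef (k.-1 + b) b (g (k.-1 + b)%N c))
  - Re (f b c * 'i%C ^+ b) * k%:R.
Proof.
rewrite /model_op /xshift leqnn subnn subst_model_lt; [|by lia|by lia].
by rewrite /fps3_Re subst_model_lt // add0n binn mul1r mulr_natr.
Qed.

Lemma model_op_k f g b c :
  model_op f g k b c =
  Im (taylor_coef (k + b) b (g (k + b)%N c))
  + Re (g b c.+1 * 'i%C ^+ b) * c.+1%:R
  - Im (f b.+1 c * 'i%C ^+ b.+1) * b.+1%:R * k%:R.
Proof.
rewrite /model_op /xshift leq_pred subst_model_ge; [|by lia|by lia].
rewrite /fps3_Re (_ : k - k.-1 = 1)%N; last by lia.
rewrite subst_model_lt; [|by lia|by lia].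
rewrite subnn add0n add1n binn binSn mul1r ImD -[X in _ - X = _]mulr_natr.
congr (_ + _ - _ * _).
  by rewrite exprSr -Re_mul_nat -Im_mul_i; congr Im; ring.
by rewrite exprSr -Im_mul_nat -[LHS]Im_mul_i; congr Im; ring.
Qed.

Lemma model_op_2k1 f g b c :
  model_op f g (2 * k).-1 b c =
  Im (taylor_coef ((2 * k).-1 + b) b (g ((2 * k).-1 + b)%N c))
  + Re (taylor_coef (k.-1 + b) b (g (k.-1 + b)%N c.+1)) * c.+1%:R
  - (Re (taylor_coef (k + b) b (f (k + b)%N c))
     - Im (f b c.+1 * 'i%C ^+ b) * c.+1%:R) * k%:R.
Proof.
rewrite /model_op /xshift ifT; last by lia.
rewrite subst_model_ge; [|by lia|by lia].
rewrite /fps3_Re (_ : (2 * k).-1 - k.-1 = k)%N; last by lia.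
rewrite (_ : (2 * k).-1 - k = k.-1)%N; last by lia.
rewrite subst_model_ge; [|by lia|by lia].
rewrite subnn add0n binn mul1r ImD ReD -[X in _ - X = _]mulr_natr.
congr (_ + _ - (_ + _) * _).
  by rewrite exprSr -Re_mul_nat -Im_mul_i; congr Im; rewrite /taylor_coef; ring.
by rewrite exprSr -Im_mul_nat -Re_mul_i; congr Re; ring.
Qed.

(** Independent of the exponent of u, since the normal form conditions
    concern the whole series X_{a,b}(u). *)
Definition normalized (a b : nat) : bool :=
  [|| a == 0, a == 1, a == k.-1, a == k | (a == (2 * k).-1) && (b <= 1)]%N.

Lemma taylor_coef0 j b z : z = 0 -> taylor_coef j b z = 0.
Proof. by move=> ->; rewrite /taylor_coef mul0r. Qed.

Let eq0_of_mul_nat (x : R) n : x * n.+1%:R = 0 -> x = 0.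
Proof. by move/eqP; rewrite mulf_eq0 pnatr_eq0 orbF => /eqP. Qed.

(** The triangular system, solved for zero in the order in which it
    determines the unknowns.  Every equation relates coefficients of one and
    the same weight, which is why the bound n can be kept throughout.  The
    last three hypotheses fix the constants of integration. *)
Lemma model_op_inj f g n :
  (forall a b c, normalized a b -> (a + b + k * c < n)%N ->
     model_op f g a b c = 0) ->
  Im (f 0%N 0%N) = 0 -> Re (f 1%N 0%N) = 0 -> Re (g 0%N 0%N) = 0 ->
  (forall j m, (j + k * m + k <= n)%N -> f j m = 0) /\
  (forall j m, (j + k * m < n)%N -> g j m = 0).
Proof.
move=> op0 Imf00 Ref10 Reg00.
have Img j m : (j + k * m < n)%N -> Im (g j m * 'i%C ^+ j) = 0.
  by move=> w; rewrite -(model_op_0 f) op0 // /normalized eqxx.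
have g0 j m : (j.+1 + k * m < n)%N -> g j.+1 m = 0.
  move=> w; apply: (@eq0_rotated _ j.+1); last exact: Img.
  apply: (@eq0_of_mul_nat _ j); apply/eqP; rewrite -oppr_eq0 -(model_op_1 f).
  by rewrite op0 // /normalized eqxx orbT.
have Ref j m : (j + k * m + k <= n)%N -> Re (f j m * 'i%C ^+ j) = 0.
  move=> w; have := model_op_k1 f g j m.
  rewrite op0; [|by rewrite /normalized eqxx !orbT|by lia].
  rewrite taylor_coef0; last first.
    by rewrite (_ : k.-1 + j = (k.-2 + j).+1)%N ?g0 //; lia.
  case: (k) k_gt0 => // k' _ /esym/eqP; rewrite sub0r oppr_eq0.
  by move=> /eqP/eq0_of_mul_nat.
have f0 j m : (j.+2 + k * m + k <= n)%N -> f j.+2 m = 0.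
  move=> w; apply: (@eq0_rotated _ j.+2); first exact: Ref.
  have := model_op_k f g j.+1 m.
  rewrite op0; [|by rewrite /normalized eqxx !orbT|by lia].
  rewrite taylor_coef0; last first.
    by rewrite (_ : k + j.+1 = (k + j).+1)%N ?g0 //; lia.
  rewrite (g0 j) ?mul0r /=; last by rewrite mulnS; lia.
  case: (k) k_gt0 => // k' _ /esym/eqP; rewrite !(add0r, sub0r) oppr_eq0.
  by move=> /eqP/eq0_of_mul_nat/eq0_of_mul_nat.
have Imf j m : (j <= 1)%N -> (j + k * m + k <= n)%N ->
    Im (f j m * 'i%C ^+ j) = 0.
  move=> j1; case: m => [|m] w.
    case: j j1 w => [|[|//]] _ w; first by rewrite mulr1.
    by rewrite expr1 Im_mul_i.
  move: w; rewrite mulnS => w; have := model_op_2k1 f g j m.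
  rewrite op0; [|by rewrite /normalized eqxx j1 !orbT|by lia].
  rewrite !taylor_coef0.
  - rewrite /= !(mul0r, add0r, sub0r) mulNr opprK.
    by case: (k) k_gt0 => // k' _ /esym/eq0_of_mul_nat/eq0_of_mul_nat.
  - by rewrite (_ : k + j = (k.-2 + j).+2)%N ?f0 //; lia.
  - by rewrite (_ : k.-1 + j = (k.-2 + j).+1)%N ?g0 // ?mulnS; lia.
  - by rewrite (_ : (2 * k).-1 + j = ((2 * k).-2 + j).+1)%N ?g0 //; lia.
have f0' j m : (j + k * m + k <= n)%N -> f j m = 0.
  move=> w; case: j w => [|[|j]] w; last exact: f0.
    by apply: (@eq0_rotated _ 0); [exact: Ref|exact: Imf].
  by apply: (@eq0_rotated _ 1); [exact: Ref|exact: Imf].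
split=> // j m w; case: j w => [|j] w; last exact: g0.
apply: (@eq0_rotated _ 0); last exact: Img.
case: m w => [_|m]; first by rewrite mulr1.
rewrite mulnS => w; have := model_op_k f g 0 m.
rewrite op0; [|by rewrite /normalized eqxx !orbT|by lia].
rewrite taylor_coef0; last first.
  by rewrite addn0 -(prednK k_gt0) g0 // prednK //; lia.
rewrite f0' ?mul0r; last by lia.
by rewrite /= ?mul0r subr0 add0r => /esym/eq0_of_mul_nat.
Qed.

Definition unrotate (x y : nat -> nat -> R) : fps2 R[i] :=
  fun j m => (x j m +i* y j m)%C / 'i%C ^+ j.

Lemma unrotateK x y j m : unrotate x y j m * 'i%C ^+ j = (x j m +i* y j m)%C.
Proof. by rewrite /unrotate divfK // expf_neq0 // i_neq0. Qed.

(** The same triangular system, solved in the same order.  Taking the three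
    constants of integration to be zero is what makes the solution satisfy the
    weight conditions, through [model_op_inj]. *)
Lemma model_op_surj P : exists fg : fps2 R[i] * fps2 R[i],
  [/\ forall a b c, normalized a b -> model_op fg.1 fg.2 a b c = P a b c,
      Im (fg.1 0%N 0%N) = 0, Re (fg.1 1%N 0%N) = 0 & Re (fg.2 0%N 0%N) = 0].
Proof.
(* x, y are the real and imaginary parts of the rotated coefficients of g,
   and r, s those of f.  The preliminary x1 omits Re g_0, and s1 omits Im f_0
   and Re f_1, which the earlier equations do not involve. *)
pose y := P 0%N.
pose x1 j c := if j is b.+1 then - P 1%N b c / b.+1%:R else 0.
pose g1 := unrotate x1 y.
pose r b c := (Im (taylor_coef (k.-1 + b) b (g1 (k.-1 + b)%N c)) - P k.-1 b c)
  / k%:R.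
pose s1 j c := if j is b.+2 then
  (Im (taylor_coef (k + b.+1) b.+1 (g1 (k + b.+1)%N c))
   + Re (g1 b.+1 c.+1 * 'i%C ^+ b.+1) * c.+1%:R - P k b.+1 c) / (b.+2%:R * k%:R)
  else 0.
pose f1 := unrotate r s1.
pose s j c := if (j <= 1)%N then
    if c is c'.+1 then
      (P (2 * k).-1 j c'
       - Im (taylor_coef ((2 * k).-1 + j) j (g1 ((2 * k).-1 + j)%N c'))
       - Re (taylor_coef (k.-1 + j) j (g1 (k.-1 + j)%N c)) * c%:R
       + Re (taylor_coef (k + j) j (f1 (k + j)%N c')) * k%:R) / (c%:R * k%:R)
    else 0
  else s1 j c.
pose f := unrotate r s.
pose x j c := if j is _.+1 then x1 j c else
  if c is c'.+1 then
    (P k 0%N c' - Im (taylor_coef (k + 0) 0 (g1 (k + 0)%N c'))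
     + Im (f 1%N c' * 'i%C ^+ 1) * k%:R) / c%:R
  else 0.
pose g := unrotate x y.
have kne : k%:R != 0 :> R by rewrite pnatr_eq0; lia.
have nne n : n.+1%:R != 0 :> R by rewrite pnatr_eq0.
have dK v n : v / (n.+1%:R * k%:R) * (n.+1%:R * k%:R) = v :> R.
  by rewrite divfK // mulf_neq0.
have gE j c : (0 < j)%N -> g j c = g1 j c by case: j.
have fE j c : (1 < j)%N -> f j c = f1 j c by case: j => [|[]].
have Reg : Re (g 0%N 0%N) = 0 by rewrite -[g _ _]mulr1 -(expr0 'i%C) unrotateK.
have Ref : Re (f 1%N 0%N) = 0 by rewrite -Im_mul_i -(expr1 'i%C) unrotateK.
have Imf : Im (f 0%N 0%N) = 0 by rewrite -[f _ _]mulr1 -(expr0 'i%C) unrotateK.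
exists (f, g); split => //.
move=> a b c; rewrite [(f, g).1]/= [(f, g).2]/=.
case/or4P => [/eqP->|/eqP->|/eqP->|/orP[/eqP->|/andP[/eqP-> b1]]].
- by rewrite model_op_0 unrotateK.
- by rewrite model_op_1 unrotateK /= divfK // opprK.
- rewrite model_op_k1 unrotateK /= gE; last by lia.
  by rewrite divfK // opprB addrC subrK.
- rewrite model_op_k gE; last by lia.
  case: b => [|b].
    by rewrite [g 0%N _ * _]unrotateK /= divfK // mulr1; ring.
  rewrite gE // [f _ _ * _]unrotateK /=.
  rewrite -mulrA /s /= dK; ring.
- rewrite model_op_2k1 !gE ?(fE (k + b)%N); try lia.
  rewrite [f _ _ * _]unrotateK /= /s b1 mulrBl -[_ / _ * _ * _]mulrA.
  rewrite dK; ring.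
Qed.

End LinearizedProblem.

(** * The nonlinear equation and its solution *)

Section NormalForm.
Variables (R : realType) (k : nat) (F : fps3 R).
Hypothesis k_gt2 : (2 < k)%N.
Hypothesis F_leading : agree k k.+1 F (fps3_mono R k 0 0).

Local Notation xk := (fps3_mono R k 0 0).

Let k_gt0 : (0 < k)%N. Proof. by lia. Qed.

Lemma agree_Re n (S T : fps3 R[i]) :
  agree k n S T -> agree k n (fps3_Re S) (fps3_Re T).
Proof. by move=> h a b c w; rewrite /fps3_Re h. Qed.

Lemma agree_Im n (S T : fps3 R[i]) :
  agree k n S T -> agree k n (fps3_Im S) (fps3_Im T).
Proof. by move=> h a b c w; rewrite /fps3_Im h. Qed.

Lemma order_ge_zM : order_ge k 1 (zM R).
Proof.
move=> a b c w; rewrite /zM /fps3_complex.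
by rewrite (@order_ge_mono R k 1 0 0 1) ?(@order_ge_mono R k 0 1 0 1) ?muln0.
Qed.

Lemma agree_wM : agree k k.+1 (wM F) (wModel R k).
Proof. by move=> a b c w; rewrite /wM /fps3_complex F_leading. Qed.

Lemma order_ge_wModel : order_ge k k (wModel R k).
Proof.
move=> a b c w; rewrite /wModel /wM /fps3_complex.
by rewrite !(@order_ge_mono R k _ _ _ k) ?addn0 ?muln0 ?muln1 ?addn0.
Qed.

Lemma order_ge_wM : order_ge k k (wM F).
Proof. apply: order_ge_agree (agree_le _ agree_wM) order_ge_wModel; lia. Qed.

Lemma fps3_ReD (S T : fps3 R[i]) a b c :
  fps3_Re (fps3_add S T) a b c = fps3_Re S a b c + fps3_Re T a b c.
Proof. exact: ReD. Qed.
Lemma fps3_ImD (S T : fps3 R[i]) a b c :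
  fps3_Im (fps3_add S T) a b c = fps3_Im S a b c + fps3_Im T a b c.
Proof. exact: ImD. Qed.

(** F* is treated as an unknown on the same footing as f and g. *)
Record candidate := Candidate {
  zpart : fps2 R[i]; wpart : fps2 R[i]; target : fps3 R }.
Implicit Types s t : candidate.

(** The bounds differ because f of weight n + 1 and g, F* of weight
    k + n enter the equation at the same weight k + n. *)
Definition close e s t := [/\
  forall j m, (j + k * m < 1 + e)%N -> zpart s j m = zpart t j m,
  forall j m, (j + k * m < k + e)%N -> wpart s j m = wpart t j m &
  agree k (k + e) (target s) (target t)].

Definition trivial_candidate : candidate :=
  Candidate (fun _ _ => 0) (fun _ _ => 0) xk.

Definition admissible s := close 1 s trivial_candidate.

Lemma close_sym e s t : close e s t -> close e t s.
Proof.
case=> h1 h2 h3; split=> [j m w|j m w|]; last exact: agree_sym.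
- by rewrite h1.
- by rewrite h2.
Qed.

Lemma close_trans e s t u : close e s t -> close e t u -> close e s u.
Proof.
case=> h1 h2 h3 [h1' h2' h3']; split=> [j m w|j m w|].
- by rewrite h1 ?h1'.
- by rewrite h2 ?h2'.
- exact: agree_trans h3 h3'.
Qed.

Lemma close_le e e' s t : (e' <= e)%N -> close e s t -> close e' s t.
Proof.
move=> le [h1 h2 h3]; split=> [j m w|j m w|]; [apply: h1|apply: h2|]; try lia.
by apply: agree_le h3; lia.
Qed.

Lemma close_eq s t : (forall e, close e.+1 s t) -> s = t.
Proof.
case: s t => f g P [f' g' P'] h; congr Candidate.
- apply/funext => j; apply/funext => m.
  by have [h1 _ _] := h (j + k * m)%N; apply: h1; lia.
- apply/funext => j; apply/funext => m.
  by have [_ h2 _] := h (j + k * m)%N; apply: h2; lia.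
- apply/funext => a; apply/funext => b; apply/funext => c.
  by have [_ _ h3] := h (a + b + k * c)%N; apply: h3; lia.
Qed.

Definition xstar s := fps3_Re (zstar (zpart s) F).
Definition ystar s := fps3_Im (zstar (zpart s) F).
Definition ustar s := fps3_Re (wstar (wpart s) F).
Definition vstar s := fps3_Im (wstar (wpart s) F).

(** Vanishes exactly when the transformation takes v = F to the target. *)
Definition defect s : fps3 R :=
  fps3_sub (vstar s) (fps3_subst (target s) (xstar s) (ystar s) (ustar s)).

Section Leading.
Variable s : candidate.
Hypothesis z0 : forall j m, (j + k * m < 2)%N -> zpart s j m = 0.
Hypothesis w0 : forall j m, (j + k * m < k.+1)%N -> wpart s j m = 0.

Let z_order : order_ge k 2 (fps2_subst (zpart s) (zM R) (wM F)).
Proof.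
by apply: order_ge_fps2_subst z0; [exact: order_ge_zM|exact: order_ge_wM].
Qed.
Let w_order : order_ge k k.+1 (fps2_subst (wpart s) (zM R) (wM F)).
Proof.
by apply: order_ge_fps2_subst w0; [exact: order_ge_zM|exact: order_ge_wM].
Qed.

Lemma xstar_leading : agree k 2 (xstar s) (fps3_mono R 1 0 0).
Proof.
by move=> a b c w; rewrite /xstar fps3_ReD {2}/fps3_Re z_order // addr0.
Qed.
Lemma ystar_leading : agree k 2 (ystar s) (fps3_mono R 0 1 0).
Proof.
by move=> a b c w; rewrite /ystar fps3_ImD {2}/fps3_Im z_order // addr0.
Qed.
Lemma ustar_leading : agree k k.+1 (ustar s) (fps3_mono R 0 0 1).
Proof.
by move=> a b c w; rewrite /ustar fps3_ReD {2}/fps3_Re w_order // addr0.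
Qed.
Lemma vstar_leading : agree k k.+1 (vstar s) xk.
Proof.
move=> a b c w; rewrite /vstar fps3_ImD {2}/fps3_Im w_order // addr0.
exact: F_leading.
Qed.

Lemma subst_target_leading n P : agree k n P xk -> (n <= k)%N ->
  agree k n.+1 (fps3_subst P (xstar s) (ystar s) (ustar s)) P.
Proof.
have outer := subst_sub_outer k_gt0 xstar_leading ystar_leading ustar_leading.
move=> aP le a b c w.
have aP0 : agree k n P (fun _ _ _ => 0).
  move=> a' b' c' w'; rewrite aP //.
  by apply: (@order_ge_mono R k k 0 0 n) => //; lia.
have := outer _ _ _ aP0 a b c w; rewrite /fps3_sub subr0 => <-.
rewrite [X in _ - X]/fps3_subst big1 ?subr0 // => j _.
by rewrite big1 // => l _; rewrite big1 // => m _; rewrite mul0r.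
Qed.

(** Lowest weights first: as z* and w* start with z and w, the lowest part of
    the target is reproduced by the substitution, and it must match that of
    Im w*, which starts with x^k. *)
Lemma target_leading : (forall a b c, defect s a b c = 0) ->
  agree k k.+1 (target s) xk.
Proof.
move=> d0; suff: forall n, (n <= k.+1)%N -> agree k n (target s) xk by apply.
elim=> [//|n IH le a b c w].
rewrite -(subst_target_leading (IH _)) //; last by lia.
rewrite -vstar_leading; last by lia.
by apply/eqP; rewrite eq_sym -subr_eq0; apply/eqP; exact: d0.
Qed.

End Leading.

Lemma model_op_sub (f f' g g' : fps2 R[i]) :
  model_op k (fps2_sub f f') (fps2_sub g g') =
  fps3_sub (model_op k f g) (model_op k f' g').
Proof.
apply/funext => a; apply/funext => b; apply/funext => c.
rewrite /fps3_sub /model_op !fps2_subst_sub /fps3_sub ImB /xshift /fps3_Re.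
by case: leqP => _; rewrite ?ReB ?mulrnBl; ring.
Qed.

Lemma order_ge_model_op (f g : fps2 R[i]) e :
  (forall j m, (j + k * m < 1 + e)%N -> f j m = 0) ->
  (forall j m, (j + k * m < k + e)%N -> g j m = 0) ->
  order_ge k (k + e) (model_op k f g).
Proof.
move=> f0 g0.
have oE h n : (forall j m, (j + k * m < n)%N -> h j m = 0) ->
    order_ge k n (fps2_subst h (zM R) (wModel R k)).
  by apply: order_ge_fps2_subst; [exact: order_ge_zM|exact: order_ge_wModel].
move=> a b c w; rewrite /model_op (oE _ _ g0) // sub0r.
rewrite (@order_ge_xshift _ k k.-1 (1 + e)) ?mul0rn ?oppr0 //; last by lia.
by move=> a' b' c' w'; rewrite /fps3_Re (oE _ _ f0).
Qed.

(** The unknowns of highest weight enter linearly: the nonlinear effects of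
    a change that starts in a given weight appear only in higher weights, since
    F and F* agree with x^k up to terms of weight greater than k. *)
Lemma defect_sub e s t : (0 < e)%N -> admissible s -> admissible t ->
  close e s t ->
  agree k (k + e).+1 (fps3_sub (defect s) (defect t))
    (fps3_sub (model_op k (fps2_sub (zpart s) (zpart t))
                 (fps2_sub (wpart s) (wpart t)))
       (fps3_sub (target s) (target t))).
Proof.
move=> e_gt0 [fs gs Ps] [ft gt Pt] [fst gst Pst].
rewrite addn1 in gs gt Ps Pt.
pose df := fps2_sub (zpart s) (zpart t).
pose dg := fps2_sub (wpart s) (wpart t).
have dxy : zstar (zpart s) F =
    fps3_add (zstar (zpart t) F) (fps2_subst df (zM R) (wM F)).
  rewrite fps2_subst_sub.
  apply/funext => a; apply/funext => b; apply/funext => c.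
  by rewrite /zstar /fps3_add /fps3_sub; ring.
have duv : wstar (wpart s) F =
    fps3_add (wstar (wpart t) F) (fps2_subst dg (zM R) (wM F)).
  rewrite fps2_subst_sub.
  apply/funext => a; apply/funext => b; apply/funext => c.
  by rewrite /wstar /fps3_add /fps3_sub; ring.
have df0 j m : (j + k * m < 1 + e)%N -> df j m = 0.
  by move=> w; rewrite /df /fps2_sub fst // subrr.
have dg0 j m : (j + k * m < k + e)%N -> dg j m = 0.
  by move=> w; rewrite /dg /fps2_sub gst // subrr.
have oZ := order_ge_zM; have oW := order_ge_wM; have oM := order_ge_wModel.
have oDf := order_ge_fps2_subst oZ oW df0.
have oDg := order_ge_fps2_subst oZ oW dg0.
have aDf := agree_fps2_subst oZ oZ oW oM (@agree_refl _ _ _ _) agree_wM df0.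
have aDg := agree_fps2_subst oZ oZ oW oM (@agree_refl _ _ _ _) agree_wM dg0.
have aX : agree k (1 + e) (xstar s) (xstar t).
  by move=> a b c w; rewrite /xstar dxy fps3_ReD {2}/fps3_Re oDf // addr0.
have aY : agree k (1 + e) (ystar s) (ystar t).
  by move=> a b c w; rewrite /ystar dxy fps3_ImD {2}/fps3_Im oDf // addr0.
have aU : agree k (k + e) (ustar s) (ustar t).
  by move=> a b c w; rewrite /ustar duv fps3_ReD {2}/fps3_Re oDg // addr0.
have main := subst_sub k_gt0 (xstar_leading fs) (ystar_leading fs)
  (ustar_leading gs) e_gt0 (xstar_leading ft) (ystar_leading ft)
  (ustar_leading gt) Pt aX aY aU Pst.
move=> a b c w.
have vE : vstar s a b c - vstar t a b c =
    fps3_Im (fps2_subst dg (zM R) (wModel R k)) a b c.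
  by rewrite /vstar duv fps3_ImD addrC addKr; apply: (agree_Im aDg).
have xE : xshift k.-1 (fps3_sub (xstar s) (xstar t)) a b c =
    xshift k.-1 (fps3_Re (fps2_subst df (zM R) (wModel R k))) a b c.
  rewrite /xshift; case: leqP => // h.
  rewrite /fps3_sub /xstar dxy fps3_ReD addrC addKr.
  by apply: (agree_Re aDf); lia.
have mE : model_op k df dg a b c = vstar s a b c - vstar t a b c -
    xshift k.-1 (fps3_sub (xstar s) (xstar t)) a b c *+ k by rewrite vE xE.
transitivity ((vstar s a b c - vstar t a b c) -
  fps3_sub (fps3_subst (target s) (xstar s) (ystar s) (ustar s))
    (fps3_subst (target t) (xstar t) (ystar t) (ustar t)) a b c).
  by rewrite /defect /fps3_sub; ring.
transitivity (model_op k df dg a b c - (target s a b c - target t a b c)) => //.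
by rewrite mE main //; ring.
Qed.

(** The form in which injectivity of the linear problem is used: candidates
    with the same low-order constants and the same normalized coefficients are
    told apart by the linear expression, weight by weight. *)
Lemma close_of_model_op e s t :
  complex.Im (zpart s 0%N 0%N) = complex.Im (zpart t 0%N 0%N) ->
  complex.Re (zpart s 1%N 0%N) = complex.Re (zpart t 1%N 0%N) ->
  complex.Re (wpart s 0%N 0%N) = complex.Re (wpart t 0%N 0%N) ->
  agree k (k + e)
    (fps3_sub (model_op k (zpart s) (wpart s)) (target s))
    (fps3_sub (model_op k (zpart t) (wpart t)) (target t)) ->
  (forall a b c, normalized k a b -> target s a b c = target t a b c) ->
  close e s t.
Proof.
move=> zI zR wR; pose df := fps2_sub (zpart s) (zpart t).
pose dg := fps2_sub (wpart s) (wpart t) => opE tE.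
have [|||| df0 dg0] := @model_op_inj R k k_gt2 df dg (k + e).
- move=> a b c nab w; rewrite model_op_sub /fps3_sub.
  have := opE a b c w; rewrite /fps3_sub tE // => /addIr ->.
  by rewrite subrr.
- by rewrite ImB zI subrr.
- by rewrite ReB zR subrr.
- by rewrite ReB wR subrr.
have fE j m : (j + k * m < 1 + e)%N -> zpart s j m = zpart t j m.
  by move=> w; apply/eqP; rewrite -subr_eq0; apply/eqP/df0; lia.
have gE j m : (j + k * m < k + e)%N -> wpart s j m = wpart t j m.
  by move=> w; apply/eqP; rewrite -subr_eq0; apply/eqP/dg0; lia.
split=> // a b c w.
have := opE a b c w; rewrite /fps3_sub.
have : model_op k df dg a b c = 0.
  apply: order_ge_model_op w => j m w; first by apply: df0; lia.
  exact: dg0.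
by rewrite model_op_sub /fps3_sub => /subr0_eq -> /addrI/oppr_inj.
Qed.

Definition normalizing s :=
  [/\ admissible s, forall a b c, defect s a b c = 0 &
      forall a b c, normalized k a b -> target s a b c = xk a b c].

Lemma admissible_low s : admissible s ->
  [/\ zpart s 0%N 0%N = 0, zpart s 1%N 0%N = 0 & wpart s 0%N 0%N = 0].
Proof. by case=> zs ws _; split; [apply: zs|apply: zs|apply: ws]; lia. Qed.

Lemma admissible_close s t : admissible s -> admissible t -> close 1 s t.
Proof. by move=> hs ht; apply: close_trans hs (close_sym ht). Qed.

Lemma normalizing_unique s t : normalizing s -> normalizing t -> s = t.
Proof.
move=> [adm_s ds ns] [adm_t dt nt]; apply: close_eq; elim=> [|e IH].
  exact: admissible_close.
have [zs0 zs1 ws0] := admissible_low adm_s.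
have [zt0 zt1 wt0] := admissible_low adm_t.
apply: close_of_model_op; rewrite ?zs0 ?zs1 ?ws0 ?zt0 ?zt1 ?wt0 //; last first.
  by move=> a b c nab; rewrite ns // nt.
move=> a b c; rewrite addnS => w.
have := defect_sub (ltn0Sn e) adm_s adm_t IH w.
rewrite model_op_sub /fps3_sub ds dt subrr => /esym dE.
by apply/eqP; rewrite -subr_eq0; apply/eqP; rewrite -[RHS]dE; ring.
Qed.

Lemma order_ge_defect s : admissible s -> order_ge k k.+1 (defect s).
Proof.
move=> [zs ws Ps] a b c w; rewrite addn1 in ws Ps.
rewrite /defect /fps3_sub (vstar_leading ws) //.
rewrite (@subst_target_leading s zs ws k) //; last by apply: agree_le Ps; lia.
by rewrite Ps // subrr.
Qed.
(** The nonlinear part of the defect, with the opposite sign: the defect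
    vanishes exactly when the linear part equals this remainder. *)
Definition remainder s : fps3 R := fun a b c =>
  model_op k (zpart s) (wpart s) a b c - (target s a b c - xk a b c)
  - defect s a b c.

(** The linear parts cancel in the difference, so one more weight agrees. *)
Lemma agree_remainder e s t : (0 < e)%N -> admissible s -> admissible t ->
  close e s t -> agree k (k + e).+1 (remainder s) (remainder t).
Proof.
move=> e_gt0 hs ht hst a b c w; have := defect_sub e_gt0 hs ht hst w.
rewrite model_op_sub /fps3_sub /remainder => dE.
by apply/eqP; rewrite -subr_eq0; apply/eqP; move: dE => /eqP; rewrite -subr_eq0
  => /eqP dE; rewrite -[RHS]oppr0 -[in RHS]dE; ring.
Qed.

Lemma order_ge_remainder s : admissible s -> order_ge k (k + 1) (remainder s).
Proof.
move=> hs; have [zs ws Ps] := hs; move=> a b c w; rewrite /remainder.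
rewrite (order_ge_defect hs); last by lia.
by rewrite Ps // subrr (order_ge_model_op zs ws) // !subr0.
Qed.

(** The right-hand side of the linear problem that T s solves is the remainder
    of s; the target absorbs what is left outside the normalized positions. *)
Definition solves_linearization (T : candidate -> candidate) := forall s,
  let t := T s in
  [/\ complex.Im (zpart t 0%N 0%N) = 0, complex.Re (zpart t 1%N 0%N) = 0,
      complex.Re (wpart t 0%N 0%N) = 0,
      forall a b c, target t a b c =
        xk a b c + model_op k (zpart t) (wpart t) a b c - remainder s a b c &
      forall a b c, normalized k a b -> target t a b c = xk a b c].

Lemma linearization_solvable : exists T, solves_linearization T.
Proof.
have [sol solP] := choice (@model_op_surj R k k_gt2).
exists (fun s => let fg := sol (remainder s) in
  Candidate fg.1 fg.2 (fun a b c =>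
    xk a b c + model_op k fg.1 fg.2 a b c - remainder s a b c)) => s /=.
have [solE zI zR wR] := solP (remainder s).
by split=> // a b c nab; rewrite solE // addrK.
Qed.

Section FixedPoint.
Variable T : candidate -> candidate.
Hypothesis T_solves : solves_linearization T.

Lemma solution_admissible s : admissible s -> admissible (T s).
Proof.
move=> hs; have [zI zR wR tE nE] := T_solves s.
apply: close_of_model_op => // a b c w.
rewrite /fps3_sub tE (order_ge_remainder hs) // subr0.
rewrite (@order_ge_model_op (fun _ _ => 0) (fun _ _ => 0) 1) //.
by ring.
Qed.

Lemma solution_contracts e s t : (0 < e)%N -> admissible s -> admissible t ->
  close e s t -> close e.+1 (T s) (T t).
Proof.
move=> e_gt0 hs ht hst.
have [zIs zRs wRs tEs nEs] := T_solves s.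
have [zIt zRt wRt tEt nEt] := T_solves t.
apply: close_of_model_op; rewrite ?zIs ?zRs ?wRs ?zIt ?zRt ?wRt //; last first.
  by move=> a b c nab; rewrite nEs // nEt.
move=> a b c; rewrite addnS => w; rewrite /fps3_sub tEs tEt.
by rewrite (agree_remainder e_gt0 hs ht hst w); ring.
Qed.

Definition approximation n := iter n T trivial_candidate.

Lemma approximation_admissible n : admissible (approximation n).
Proof. by elim: n => [|n IH]; [split|exact: solution_admissible]. Qed.

Lemma approximation_step n : close n.+1 (approximation n) (approximation n.+1).
Proof.
elim: n => [|n IH].
  apply: admissible_close; exact: approximation_admissible.
by apply: solution_contracts IH => //; exact: approximation_admissible.
Qed.

Lemma approximation_close n m : (n <= m)%N ->
  close n.+1 (approximation m) (approximation n).
Proof.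
elim: m => [|m IH]; first by rewrite leqn0 => /eqP->; split.
rewrite leq_eqVlt => /orP[/eqP->|lt]; first by split.
apply: close_trans (IH _); last by lia.
by apply: close_le (close_sym (approximation_step m)); lia.
Qed.

(** Any index at which the coefficient has become stationary would do; by
    [approximation_step] the weight of the coefficient is large enough. *)
Definition limit := Candidate
  (fun j m => zpart (approximation (j + k * m)) j m)
  (fun j m => wpart (approximation (j + k * m)) j m)
  (fun a b c => target (approximation (a + b + k * c)) a b c).

Lemma limit_close n : close n.+1 limit (approximation n).
Proof.
have le := @approximation_close.
split=> [j m w|j m w|a b c w] /=.
- have [h|h] := leqP n (j + k * m).
    by have [H _ _] := le _ _ h; apply: H.
  by have [H _ _] := le _ _ (ltnW h); rewrite H //; lia.
- have [h|h] := leqP n (j + k * m).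
    by have [_ H _] := le _ _ h; apply: H.
  by have [_ H _] := le _ _ (ltnW h); rewrite H //; lia.
- have [h|h] := leqP n (a + b + k * c).
    by have [_ _ H] := le _ _ h; apply: H.
  by have [_ _ H] := le _ _ (ltnW h); rewrite H //; lia.
Qed.

Lemma limit_admissible : admissible limit.
Proof. exact: (limit_close 0). Qed.

(** T maps the limit close to every approximation, hence close to itself. *)
Lemma limit_fixed : T limit = limit.
Proof.
apply: close_eq => e.
have Te : close e.+2 (T limit) (approximation e.+1).
  apply: solution_contracts (limit_close e) => //.
    exact: limit_admissible.
  exact: approximation_admissible.
apply: (@close_le e.+2) => //.
exact: close_trans Te (close_sym (limit_close _)).
Qed.

Lemma limit_normalizing : normalizing limit.
Proof.
have [_ _ _ tE nE] := T_solves limit; rewrite limit_fixed in tE nE.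
split=> //; first exact: limit_admissible.
move=> a b c; have := tE a b c; rewrite /remainder => E.
have -> : defect limit a b c = xk a b c +
   model_op k (zpart limit) (wpart limit) a b c -
   (model_op k (zpart limit) (wpart limit) a b c -
     (target limit a b c - xk a b c) - defect limit a b c)
   - target limit a b c by ring.
by rewrite -E subrr.
Qed.

End FixedPoint.

Lemma normalizing_exists : exists s, normalizing s.
Proof.
have [T hT] := linearization_solvable.
by exists (limit T); exact: limit_normalizing.
Qed.

Lemma t_normalP P : (forall a b c, normalized k a b -> P a b c = xk a b c) <->
  t_normal k P.
Proof.
split=> [h|[h1 h2] a b c].
  have h0 a b c : normalized k a b -> X k P a b c = 0.
    by move=> nab; rewrite /X /A h // subrr.
  by split=> *; split; apply: h0; rewrite /normalized eqxx ?orbT.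
rewrite -[xk a b c]add0r => /or4P nab; apply/eqP; rewrite -subr_eq; apply/eqP.
have [e0 e1 e2 e3] := h1 b c.
case: nab => [/eqP->|/eqP->|/eqP->|/orP[/eqP->|/andP[/eqP->]]] //.
by have [e4 e5] := h2 c; case: b {e0 e1 e2 e3} => [|[|]].
Qed.

Lemma normalizingP f g : (exists P, normalizing (Candidate f g P)) <->
  [/\ forall j m : nat, f j m <> 0 -> (1 < j + k * m)%N,
      forall j m : nat, g j m <> 0 -> (k < j + k * m)%N
    & exists P : fps3 R, takes f g F P /\ t_normal k P].
Proof.
split=> [[P [[/= f0 g0 P0] d0 nP]]|[f0 g0 [P [tk tn]]]].
  split=> [j m /eqP|j m /eqP|].
  - by rewrite ltnNge; apply: contraNN => le; rewrite f0 //; lia.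
  - by rewrite ltnNge; apply: contraNN => le; rewrite g0 //; lia.
  - exists P; split; last exact/t_normalP.
    by move=> a b c; apply/eqP; rewrite -subr_eq0; apply/eqP; exact: d0.
have fz j m : (j + k * m < 2)%N -> f j m = 0.
  by move=> w; apply/eqP; apply: contraTT w => /eqP/f0; lia.
have gz j m : (j + k * m < k.+1)%N -> g j m = 0.
  by move=> w; apply/eqP; apply: contraTT w => /eqP/g0; lia.
have d0 a b c : defect (Candidate f g P) a b c = 0.
  by apply/eqP; rewrite /defect /fps3_sub subr_eq0; apply/eqP; exact: tk.
exists P; split=> //; last exact/t_normalP.
split=> //=; rewrite addn1; first exact: gz.
exact: (@target_leading (Candidate f g P)).
Qed.

End NormalForm.

Theorem proposition3p1 (R : realType) (k : nat) (F : fps3 R)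
    (hk : (2 < k)%N)
    (hF : forall j l m : nat, A k F j l m <> 0 -> (k + 1 <= j + l + k * m)%N) :
  exists! fg : fps2 R[i] * fps2 R[i],
    [/\ forall j m : nat, fg.1 j m <> 0 -> (1 < j + k * m)%N,
        forall j m : nat, fg.2 j m <> 0 -> (k < j + k * m)%N
      & exists Fstar : fps3 R, takes fg.1 fg.2 F Fstar /\ t_normal k Fstar].
Proof.
have Fx : agree k k.+1 F (fps3_mono R k 0 0).
  move=> a b c w; apply/eqP; rewrite -subr_eq0.
  by apply: contraTT w => /eqP/hF; lia.
have [[f g P] sol] := normalizing_exists hk Fx.
exists (f, g); split; first by apply/(normalizingP hk Fx); exists P.
move=> [f' g'] /(normalizingP hk Fx) [P' sol'].
by case: (normalizing_unique hk Fx sol sol') => -> ->.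
Qed.
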